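(* Let $A$ be an associative Look-Up Table on a finite set $\chi\subset\mathbb{R}$, with associated operation $\oplus$, and let $\{X_k\}_{k\in\mathbb{N}}$ be a sequence of independent identically distributed random variables taking values in $\chi$. If for some random variable $\xi$ one has $$X_1\oplus\cdots\oplus X_m \xrightarrow{d} \xi,\qquad m\to\infty,$$ then $\xi$ is $A$-stable.
   Context: Let $\chi=\{x_1,\dots,x_N\}$, $N\in\mathbb{N}$, be a finite set of distinct real numbers. A Look-Up Table is a matrix $A=(A(j,k))_{j,k=1}^N\in\chi^{N\times N}$; it defines a binary operation on $\chi$ (pseudo-summation) by $x_j\oplus x_k = A(j,k)$. The Look-Up Table $A$ is called associative if $x\oplus(y\oplus z)=(x\oplus y)\oplus z$ for all $x,y,z\in\chi$. A random variable $\xi$ taking values in $\chi$ is called $A$-stable if $\xi_1\oplus\xi_2$ has the same distribution as $\xi$, where $\xi_1,\xi_2$ are independent copies of $\xi$. The symbol $\xrightarrow{d}$ denotes convergence in distribution. *)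

(* Defs.v *)
From HB Require Import structures.
From mathcomp Require Import all_boot all_order all_algebra.
From mathcomp Require Import all_classical all_reals all_analysis.

Set Implicit Arguments.
Unset Strict Implicit.
Unset Printing Implicit Defensive.

Import Order.TTheory GRing.Theory Num.Theory.
Import numFieldNormedType.Exports.

Local Open Scope classical_set_scope.
Local Open Scope ring_scope.

(* The finite set chi of N distinct reals is [range x] for an injective
   enumeration [x : 'I_N -> R]. *)

Definition lookup_table (R : realType) (N : nat) (x : 'I_N -> R)
    (A : 'M[R]_N) : Prop :=
  forall j k, range x (A j k).

(* [oplus x A (x j) (x k) = A j k] when [x] is injective (see [oplusE]); the
   value 0 outside chi is junk that makes the operation total on R. *)
Definition oplus (R : realType) (N : nat) (x : 'I_N -> R) (A : 'M[R]_N)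
    (u v : R) : R :=
  match [pick j | x j == u], [pick k | x k == v] with
  | Some j, Some k => A j k
  | _, _ => 0
  end.

Definition lut_associative (R : realType) (N : nat) (x : 'I_N -> R)
    (A : 'M[R]_N) : Prop :=
  forall u v w, range x u -> range x v -> range x w ->
    oplus x A u (oplus x A v w) = oplus x A (oplus x A u v) w.

Lemma oplusE (R : realType) (N : nat) (x : 'I_N -> R) (A : 'M[R]_N) :
  injective x -> forall j k, oplus x A (x j) (x k) = A j k.
Proof.
move=> x_inj j k; rewrite /oplus.
case: pickP => [j' /eqP/x_inj ->|/(_ j)]; last by rewrite eqxx.
by case: pickP => [k' /eqP/x_inj ->|/(_ k)]; last by rewrite eqxx.
Qed.

Lemma measurable_pick (R : realType) (N : nat) (x : 'I_N -> R)
    (D : set (option 'I_N)) :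
  measurable [set u : R | D [pick j | x j == u]].
Proof.
have H (E : set (option 'I_N)) : ~ E None ->
    measurable [set u : R | E [pick j | x j == u]].
  move=> nE; apply: countable_measurable => [r|]; [exact: measurable_set1|apply: finite_set_countable].
  apply: (@sub_finite_set _ _ (range x)); last exact: finite_image.
  by move=> u /=; case: pickP => // j /eqP <- _; exists j.
have [DN|nD] := pselect (D None); last exact: H.
rewrite -[X in measurable X]setCK; apply: measurableC.
by apply: (H (~` D)); apply.
Qed.

Section oplus_rv.
Context d (T : measurableType d) (R : realType) (N : nat).
Variables (x : 'I_N -> R) (A : 'M[R]_N) (X Y : {mfun T >-> R}).

Definition oplus_rv (t : T) : R := oplus x A (X t) (Y t).

Let measurable_oplus_rv : measurable_fun setT oplus_rv.
Proof.
move=> _ B _; rewrite setTI.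
pose h (p : option 'I_N * option 'I_N) : R :=
  if p is (Some j, Some k) then A j k else 0.
pose i (u : R) := [pick j | x j == u].
have -> : oplus_rv @^-1` B = \bigcup_(p in [set p | B (h p)])
    (X @^-1` [set u | i u = p.1] `&` Y @^-1` [set u | i u = p.2]).
  rewrite /oplus_rv /oplus; apply/seteqP; split=> t /=.
    have -> : (match [pick j | x j == X t], [pick k | x k == Y t] with
      | Some j, Some k => A j k | _, _ => 0 end) = h (i (X t), i (Y t)).
      by rewrite /h /i; case: pickP => //= ? _; case: pickP.
    by move=> Bt; exists (i (X t), i (Y t)).
  by move=> [[p q] /= Bp [pX qY]]; move: Bp; rewrite /h -pX -qY /i;
    case: pickP => //= ? _; case: pickP.
apply: fin_bigcup_measurable; first exact: finite_finset.
move=> p _; apply: measurableI; apply: measurable_funPTI.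
  exact: (measurable_pick x [set o | o = p.1]).
exact: (measurable_pick x [set o | o = p.2]).
Qed.

HB.instance Definition _ :=
  isMeasurableFun.Build _ _ _ _ oplus_rv measurable_oplus_rv.

End oplus_rv.

(* [oplus_sum x A X n] is [X 0 (+) ... (+) X n], that is n + 1 terms, bracketed
   to the left. *)
Fixpoint oplus_sum d (T : measurableType d) (R : realType) (N : nat)
    (x : 'I_N -> R) (A : 'M[R]_N) (X : nat -> {mfun T >-> R}) (n : nat) :
    {mfun T >-> R} :=
  if n is m.+1 then oplus_rv x A (oplus_sum x A X m) (X m.+1) else X 0%N.

Definition takes_values_in d (T : measurableType d) (R : realType)
    (P : probability T R) (X : {RV P >-> R}) (chi : set R) : Prop :=
  {ae P, forall t, chi (X t)}.

Definition same_law d1 (T1 : measurableType d1) d2 (T2 : measurableType d2)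
    (R : realType) (P1 : probability T1 R) (P2 : probability T2 R)
    (X : {RV P1 >-> R}) (Y : {RV P2 >-> R}) : Prop :=
  forall B : set R, measurable B -> distribution P1 X B = distribution P2 Y B.

Definition independent_pair d (T : measurableType d) (R : realType)
    (P : probability T R) (X Y : {RV P >-> R}) : Prop :=
  forall B C : set R, measurable B -> measurable C ->
    P (X @^-1` B `&` Y @^-1` C) = (P (X @^-1` B) * P (Y @^-1` C))%E.

Definition independent_seq d (T : measurableType d) (R : realType)
    (P : probability T R) (X : nat -> {RV P >-> R}) : Prop :=
  forall (s : seq nat) (B : nat -> set R),
    uniq s -> (forall i, measurable (B i)) ->
    P (\bigcap_(i in [set` s]) (X i @^-1` B i)) =
    (\prod_(i <- s) P (X i @^-1` B i))%E.

Definition iid d (T : measurableType d) (R : realType)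
    (P : probability T R) (X : nat -> {RV P >-> R}) : Prop :=
  independent_seq X /\ forall i j, same_law (X i) (X j).

Definition cvg_in_distribution d1 (T1 : measurableType d1)
    d2 (T2 : measurableType d2) (R : realType)
    (P1 : probability T1 R) (P2 : probability T2 R)
    (Y : nat -> {RV P1 >-> R}) (xi : {RV P2 >-> R}) : Prop :=
  forall a : R, {for a, continuous (cdf xi)} ->
    cdf (Y n) a @[n --> \oo] --> cdf xi a.

(* The independent copies may live on any probability space; such copies always
   exist, e.g. the two coordinates on the square of the space of [xi]. *)
Definition lut_stable d (T : measurableType d) (R : realType)
    (P : probability T R) (N : nat) (x : 'I_N -> R) (A : 'M[R]_N)
    (xi : {RV P >-> R}) : Prop :=
  takes_values_in xi (range x) /\
  forall d' (T' : measurableType d') (P' : probability T' R)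
    (xi1 xi2 : {RV P' >-> R}),
    same_law xi1 xi -> same_law xi2 xi -> independent_pair xi1 xi2 ->
    same_law (oplus_rv x A xi1 xi2 : {RV P' >-> R}) xi.

(* Main.v *)
Require Import Defs.
From mathcomp Require Import all_boot all_order all_algebra.
From mathcomp Require Import all_classical all_reals all_analysis.
From mathcomp Require Import lra.
Set Implicit Arguments.
Unset Strict Implicit.
Unset Printing Implicit Defensive.
Local Open Scope classical_set_scope.
Local Open Scope ring_scope.

Import Order.TTheory GRing.Theory Num.Theory.
Import numFieldNormedType.Exports.

(** The law of a variable with values in chi is given by its weights at the
    points of chi, and the weights of a pseudo-sum of two independent variables
    are the convolution of their weights along the operation ([pmf_oplus]).

    Let [S n] be the pseudo-sum of the first [n + 1] variables. It is
    independent of the later ones ([oplus_sum_independent]), so its weights are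
    a convolution power of the common weights of the [X k]; as the operation is
    associative, so is convolution, and the weights of [S (n + k).+1] are the
    convolution of those of [S n] and [S k] ([pmf_oplus_sumD]).

    Since chi is finite, convergence in distribution implies convergence of the
    weights ([cvg_pmf]); in particular the limit is carried by chi. Taking
    [k = n] and letting [n] tend to infinity shows that the weights of [xi] are
    equal to their own convolution square, which is the stability of [xi]. *)

(** * The operation on indices, and convolution *)

(** The operation on chi transported to indices: [x (prod_index x A a b)] is
    [A a b]. The default value [a] is never used when [A] is a look-up table
    ([prod_indexE]). *)
Definition prod_index (R : realType) (N : nat) (x : 'I_N -> R)
    (A : 'M[R]_N) (a b : 'I_N) : 'I_N :=
  odflt a [pick c | x c == A a b].

Lemma prod_indexE (R : realType) (N : nat) (x : 'I_N -> R) (A : 'M[R]_N) :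
  lookup_table x A -> forall a b, x (prod_index x A a b) = A a b.
Proof.
move=> A_lut a b; rewrite /prod_index; case: pickP => [c /eqP //|].
by have [c _ xc] := A_lut a b => /(_ c); rewrite xc eqxx.
Qed.

Lemma prod_indexA (R : realType) (N : nat) (x : 'I_N -> R) (A : 'M[R]_N) :
  injective x -> lookup_table x A -> lut_associative x A ->
  associative (prod_index x A).
Proof.
move=> x_inj A_lut A_assoc a b c; apply: (x_inj).
have H := prod_indexE A_lut.
have := A_assoc (x a) (x b) (x c).
rewrite !oplusE// -!H !oplusE// -!H.
by apply; [exists a|exists b|exists c].
Qed.

Section convolution.
Context (R : comNzRingType) (N : nat) (m : 'I_N -> 'I_N -> 'I_N).

(** The convolution of two weights [p] and [q] with respect to the operation
    [m]: when [p] and [q] are probability weights, [conv p q] is the weight of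
    [m a b] for independent [a] and [b] with weights [p] and [q]. *)
Definition conv (p q : 'I_N -> R) (c : 'I_N) : R :=
  \sum_a \sum_b (m a b == c)%:R * (p a * q b).

(** Integration against a convolution. Together with indicator functions [h],
    it turns associativity of [m] into associativity of [conv]. *)
Lemma sum_conv (p q h : 'I_N -> R) :
  \sum_c conv p q c * h c = \sum_a \sum_b p a * q b * h (m a b).
Proof.
under eq_bigr do rewrite mulr_suml.
rewrite exchange_big; apply: eq_bigr => a _ /=.
under eq_bigr do rewrite mulr_suml.
rewrite exchange_big; apply: eq_bigr => b _ /=.
rewrite (bigD1 (m a b))//= eqxx mul1r big1 ?addr0// => c /negPf cm.
by rewrite eq_sym cm !mul0r.
Qed.

Lemma convA : associative m -> forall p q r,
  conv p (conv q r) = conv (conv p q) r.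
Proof.
move=> mA p q r; apply/funext => c; rewrite {1}/conv.
transitivity (\sum_a \sum_b \sum_e (m a (m b e) == c)%:R * (p a * q b * r e)).
  apply: eq_bigr => a _.
  transitivity (\sum_e conv q r e * ((m a e == c)%:R * p a)).
    by apply: eq_bigr => e _; rewrite mulrA mulrC.
  rewrite sum_conv; apply: eq_bigr => b _; apply: eq_bigr => e _.
  by rewrite mulrC -!mulrA.
rewrite /conv [RHS]exchange_big /=.
transitivity (\sum_e \sum_a \sum_b
    (m a (m b e) == c)%:R * (p a * q b * r e)).
  by rewrite [RHS]exchange_big /=; apply: eq_bigr => a _; rewrite exchange_big.
apply: eq_bigr => e _.
transitivity (\sum_d conv p q d * ((m d e == c)%:R * r e)).
  rewrite sum_conv; apply: eq_bigr => a _; apply: eq_bigr => b _.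
  by rewrite mA mulrCA.
by apply: eq_bigr => d _; rewrite mulrCA.
Qed.

End convolution.

(** * Laws carried by a finite set *)

Lemma probability_fineE d (T : measurableType d) (R : realType)
    (P : probability T R) (E : set T) :
  measurable E -> P E = (fine (P E))%:E.
Proof. by move=> mE; rewrite fineK// fin_num_measure. Qed.

Section atoms.
Context d (T : measurableType d) (R : realType) (P : probability T R).
Context (N : nat) (x : 'I_N -> R) (x_inj : injective x).
Implicit Types (U V : {RV P >-> R}) (E : set T).

Let mpre U (r : R) : measurable (U @^-1` [set r]).
Proof. exact: measurable_funPTI. Qed.

Let bigsetU_atoms U :
  \big[setU/set0]_j (U @^-1` [set x j]) = U @^-1` range x.
Proof.
rewrite -(bigcup_pred predT); apply/seteqP; split => t /=.
  by move=> [j _ /= ->]; exists j.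
by move=> [j _ xj]; exists j.
Qed.

Lemma total_probability U E : takes_values_in U (range x) -> measurable E ->
  P E = (\sum_j P (E `&` U @^-1` [set x j]))%E.
Proof.
move=> Ux mE.
pose G := \big[setU/set0]_j (U @^-1` [set x j]).
have mG : measurable G by apply: bigsetU_measurable => j _; exact: mpre.
have PG0 : P (E `\` G) = 0%E.
  apply: measure_negligible; first exact: measurableD.
  by apply: negligibleS Ux; rewrite /G bigsetU_atoms => t [].
rewrite (measureDI P mE mG) [X in (X + _)%E]PG0 add0e big_distrr /=.
rewrite measure_bigsetU_ord//.
rewrite (trivIset_comp (fun r => E `&` U @^-1` [set r])); last exact: in2W.
exact: trivIset_preimage1_in.
Qed.

Lemma distribution_sum U (B : set R) : takes_values_in U (range x) ->
  measurable B ->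
  P (U @^-1` B) = (\sum_(j | x j \in B) (pmf U (x j))%:E)%E.
Proof.
move=> Ux mB.
have mUB : measurable (U @^-1` B) by exact: measurable_funPTI.
rewrite (total_probability Ux mUB) [RHS]big_mkcond /=; apply: eq_bigr => j _.
rewrite -preimage_setI; case: ifPn => [/set_mem Bj|/negP jB].
  by rewrite setI1 mem_set// /pmf -probability_fineE.
by rewrite setI1 memNset ?preimage_set0 ?measure0// => /mem_set.
Qed.

Lemma sum_pmf U : takes_values_in U (range x) -> \sum_j pmf U (x j) = 1.
Proof.
move=> Ux; apply: EFin_inj; rewrite -sumEFin -(probability_setT P).
rewrite -(preimage_setT U) (distribution_sum Ux)//.
by apply: eq_bigl => j; rewrite in_setT.
Qed.

(** A law has no mass outside chi as soon as its atoms in chi have total mass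
    one. *)
Lemma takes_values_in_sum_pmf U :
  \sum_j pmf U (x j) = 1 -> takes_values_in U (range x).
Proof.
pose G := \big[setU/set0]_j (U @^-1` [set x j]).
have mG : measurable G by apply: bigsetU_measurable => j _; exact: mpre.
move=> U1; exists (~` G).
split; [exact: measurableC| |by rewrite /G bigsetU_atoms].
rewrite probability_setC// /G measure_bigsetU_ord//; last first.
  rewrite (trivIset_comp (fun r => U @^-1` [set r])); last exact: in2W.
  exact: trivIset_preimage1.
rewrite [X in (_ - X)%E](_ : _ = (\sum_j pmf U (x j))%:E).
  by rewrite U1 subee.
by rewrite -sumEFin; apply: eq_bigr => j _; exact: probability_fineE.
Qed.

(** * Laws of pseudo-sums *)

Section oplus.
Variable A : 'M[R]_N.
Hypothesis A_lut : lookup_table x A.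
Notation m := (prod_index x A).

Lemma takes_values_in_oplus U V :
  takes_values_in U (range x) -> takes_values_in V (range x) ->
  takes_values_in (oplus_rv x A U V : {RV P >-> R}) (range x).
Proof.
rewrite /takes_values_in; apply: filterS2 => t [a _ xa] [b _ xb].
rewrite /= /oplus_rv -xa -xb oplusE//.
exact: A_lut.
Qed.

(** If the probability that [U = x a], [V = x b] and [E] hold together is
    always the product of the three probabilities, then the probability that
    [oplus_rv x A U V = x c] and [E] hold together is the convolution of the
    weights of [U] and [V], times the probability of [E]. *)
Lemma probability_oplus U V E :
  takes_values_in U (range x) -> takes_values_in V (range x) ->
  measurable E ->
  (forall a b,
    P (U @^-1` [set x a] `&` (V @^-1` [set x b] `&` E)) =
    (P (U @^-1` [set x a]) * (P (V @^-1` [set x b]) * P E))%E) ->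
  forall c, P (oplus_rv x A U V @^-1` [set x c] `&` E) =
    ((conv m (pmf U \o x) (pmf V \o x) c)%:E * P E)%E.
Proof.
move=> Ux Vx mE UVE c.
pose S : {RV P >-> R} := oplus_rv x A U V.
have mSE : measurable (S @^-1` [set x c] `&` E) by exact: measurableI.
rewrite (total_probability Ux)// /conv [P E]probability_fineE// -EFinM.
rewrite mulr_suml -sumEFin.
apply: eq_bigr => a _.
rewrite (total_probability Vx) 1?mulr_suml -?sumEFin; last exact: measurableI.
apply: eq_bigr => b _.
have [mab|mab] := eqVneq (m a b) c; last first.
  rewrite !mul0r [X in P X](_ : _ = set0) ?measure0// -subset0.
  move=> t [[[/= + _] ta] tb]; rewrite /oplus_rv ta tb oplusE//.
  by rewrite -(prod_indexE A_lut) => /x_inj/eqP; exact/negP.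
rewrite mul1r -mulrA !EFinM /= -!probability_fineE// -UVE; congr (P _).
apply/seteqP; split => t /=; first by move=> [[[_ ?] ?] ?].
move=> [ta [tb Et]]; do 3 split => //.
by rewrite /oplus_rv ta tb oplusE// -(prod_indexE A_lut) mab.
Qed.

Lemma pmf_oplus U V : independent_pair U V ->
  takes_values_in U (range x) -> takes_values_in V (range x) ->
  forall c, pmf (oplus_rv x A U V : {RV P >-> R}) (x c) =
    conv m (pmf U \o x) (pmf V \o x) c.
Proof.
move=> UV Ux Vx c; apply: EFin_inj; rewrite /pmf -probability_fineE//.
have := @probability_oplus U V setT Ux Vx measurableT _ c.
rewrite setIT probability_setT mule1; apply => a b.
by rewrite setIT mule1; exact: UV.
Qed.

Section partial_sums.
Variable X : nat -> {RV P >-> R}.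
Hypothesis X_chi : forall k, takes_values_in (X k) (range x).
Hypothesis X_iid : iid X.
Hypothesis mA : associative m.

Notation S n := (oplus_sum x A X n : {RV P >-> R}).

Lemma takes_values_in_oplus_sum n : takes_values_in (S n) (range x).
Proof. by elim: n => [|n IH] /=; [|apply: takes_values_in_oplus]. Qed.

Lemma pmf_iid i j : pmf (X i) = pmf (X j).
Proof.
by apply/funext => r; rewrite /pmf; congr fine; exact: (X_iid.2 i j [set r]).
Qed.

(** The pseudo-sum of [X 0], ..., [X n] is independent of any finite family of
    events on the variables of index larger than [n]. For the induction, the
    family is arbitrary: the event on [X n.+1] is absorbed into it. *)
Lemma oplus_sum_independent n (s : seq nat) (B : nat -> set R) c :
  uniq s -> (forall i, i \in s -> (n < i)%N) -> (forall i, measurable (B i)) ->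
  P (S n @^-1` [set x c] `&` \bigcap_(i in [set` s]) (X i @^-1` B i)) =
  (P (S n @^-1` [set x c]) * P (\bigcap_(i in [set` s]) (X i @^-1` B i)))%E.
Proof.
have mI (t : seq nat) (C : nat -> set R) : (forall i, measurable (C i)) ->
    measurable (\bigcap_(i in [set` t]) (X i @^-1` C i)).
  by move=> mC; apply: bigcap_measurableType => i _; exact: measurable_funPTI.
have I_cons (k : nat) (t : seq nat) (C : nat -> set R) D : k \notin t ->
    \bigcap_(i in [set` k :: t]) (X i @^-1` (if i == k then D else C i)) =
    X k @^-1` D `&` \bigcap_(i in [set` t]) (X i @^-1` C i).
  move=> kt; apply/seteqP; split => z /=.
    move=> H; split; first by have := H k; rewrite /= mem_head eqxx; apply.
    move=> i /= it; have := H i; rewrite /= inE it orbT => /(_ isT).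
    by case: eqP => // ik; move: kt; rewrite -ik it.
  move=> [zk zt] i /=; rewrite inE; case: eqP => [->//|_] /=; exact: zt.
have P_cons (k : nat) (t : seq nat) (C : nat -> set R) D :
    uniq (k :: t) -> (forall i, measurable (C i)) ->
    measurable D ->
    P (X k @^-1` D `&` \bigcap_(i in [set` t]) (X i @^-1` C i)) =
    (P (X k @^-1` D) * P (\bigcap_(i in [set` t]) (X i @^-1` C i)))%E.
  move=> /[dup] ukt /= /andP[kt ut] mC mD; rewrite -I_cons//.
  rewrite X_iid.1//; last by move=> i; case: ifP.
  rewrite X_iid.1// big_cons eqxx; congr (_ * _)%E.
  rewrite big_seq [RHS]big_seq; apply: eq_bigr => i it; case: eqP => // ik.
  by move: kt; rewrite -ik it.
elim: n s B c => [|n IH] s B c us ns mB /=.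
  apply: P_cons => //=; rewrite us andbT.
  by apply/negP => /ns.
have step (t : seq nat) (C : nat -> set R) :
    uniq t -> (forall i, i \in t -> (n.+1 < i)%N) ->
    (forall i, measurable (C i)) ->
    forall a b,
      P (S n @^-1` [set x a] `&` (X n.+1 @^-1` [set x b] `&`
        \bigcap_(i in [set` t]) (X i @^-1` C i))) =
      (P (S n @^-1` [set x a]) * (P (X n.+1 @^-1` [set x b]) *
        P (\bigcap_(i in [set` t]) (X i @^-1` C i))))%E.
  move=> ut nt mC a b.
  have nt1 : n.+1 \notin t by apply/negP => /nt; rewrite ltnn.
  rewrite -P_cons//=; last by rewrite nt1.
  rewrite -I_cons// IH//=; first by rewrite nt1.
  - by move=> i; rewrite inE => /predU1P[->//|/nt]; exact: ltnW.
  - by move=> i; case: ifP.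
have Sx := takes_values_in_oplus_sum n.
rewrite (probability_oplus Sx (X_chi n.+1) (mI _ B mB) (step s B us ns mB)).
congr (_ * _)%E; rewrite -[X in _ = P X]setIT.
have IT : \bigcap_(i in [set` [::]]) (X i @^-1` B i) = setT.
  by rewrite set_nil bigcap_set0.
(* The same formula, with the empty list of events, computes the law of the
   pseudo-sum by itself. *)
rewrite -IT (probability_oplus Sx (X_chi n.+1) (mI _ B mB)); last exact: step.
by rewrite IT probability_setT mule1.
Qed.

Lemma pmf_oplus_sumS n c : pmf (S n.+1) (x c) =
  conv m (pmf (S n) \o x) (pmf (X 0%N) \o x) c.
Proof.
rewrite (pmf_iid 0 n.+1).
apply: EFin_inj; rewrite /pmf -probability_fineE//=.
have := @probability_oplus (S n) (X n.+1) setT (takes_values_in_oplus_sum n)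
  (X_chi n.+1) measurableT _ c.
rewrite setIT probability_setT mule1; apply => a b.
rewrite setIT mule1.
have /= := @oplus_sum_independent n [:: n.+1] (fun=> [set x b]) a.
rewrite set_cons1 bigcap_set1; apply => // i; by rewrite inE => /eqP ->.
Qed.

(** The pseudo-sum of [n + k + 2] terms has the law of the independent
    pseudo-sum of [n + 1] and [k + 1] terms; this is where associativity of the
    operation is used. *)
Lemma pmf_oplus_sumD n k c : pmf (S (n + k).+1) (x c) =
  conv m (pmf (S n) \o x) (pmf (S k) \o x) c.
Proof.
elim: k c => [|k IH] c; first by rewrite addn0 pmf_oplus_sumS.
rewrite addnS pmf_oplus_sumS.
have -> : pmf (S (n + k).+1) \o x = conv m (pmf (S n) \o x) (pmf (S k) \o x).
  by apply/funext => j /=; rewrite IH.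
rewrite -convA//; congr (conv _ _ _ c).
by apply/funext => j /=; rewrite pmf_oplus_sumS.
Qed.

End partial_sums.
End oplus.
End atoms.

Lemma same_law_pmf (R : realType) (N : nat) (x : 'I_N -> R)
    d1 (T1 : measurableType d1) (P1 : probability T1 R) (U : {RV P1 >-> R})
    d2 (T2 : measurableType d2) (P2 : probability T2 R) (V : {RV P2 >-> R}) :
  injective x ->
  takes_values_in U (range x) -> takes_values_in V (range x) ->
  (forall j, pmf U (x j) = pmf V (x j)) -> same_law U V.
Proof.
move=> x_inj Ux Vx UV B mB; rewrite /distribution/= /pushforward.
rewrite (distribution_sum x_inj Ux)// (distribution_sum x_inj Vx)//.
by apply: eq_bigr => j _; rewrite UV.
Qed.

(** * Continuity points of a distribution function *)

Section cdf_windows.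
Context d (T : measurableType d) (R : realType) (P : probability T R).
Variable U : {RV P >-> R}.

Let f r := fine (cdf U r).

Let cdfE r : cdf U r = (f r)%:E.
Proof. by rewrite /f fineK// fin_num_measure. Qed.

Let f_homo r s : r <= s -> f r <= f s.
Proof. by move=> rs; rewrite -lee_fin -!cdfE cdf_nondecreasing. Qed.

Lemma cdfB_itv (u v : R) : u <= v ->
  fine (cdf U v) - fine (cdf U u) = fine (P (U @^-1` `]u, v])).
Proof.
move=> uv; have mI (i : interval R) : measurable (U @^-1` [set` i]).
  exact: measurable_funPTI.
apply: EFin_inj; rewrite -probability_fineE// EFinB -!cdfE.
rewrite /cdf /distribution/= /pushforward.
rewrite [X in (X - _)%E](measureDI P (mI _) (mI `]-oo, u])).
have -> : U @^-1` `]-oo, v] `\` U @^-1` `]-oo, u] = U @^-1` `]u, v].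
  apply/seteqP; split => t /=; rewrite !in_itv/=.
    by move=> [-> /negP]; rewrite -ltNge => ->.
  by move=> /andP[ut ->]; split => //; apply/negP; rewrite -ltNge.
have -> : U @^-1` `]-oo, v] `&` U @^-1` `]-oo, u] = U @^-1` `]-oo, u].
  apply/setIidr => t /=; rewrite !in_itv/=.
  by move=> /le_trans; apply.
by rewrite addeK// fin_num_measure.
Qed.

(** The mass of the window of half-width 1 / (n + 1) around [r] tends to the
    mass of the atom [r]. *)
Lemma cvg_cdf_window (r : R) :
  (fine (cdf U (r + n.+1%:R^-1)) - fine (cdf U (r - n.+1%:R^-1)))
    @[n --> \oo] --> pmf U r.
Proof.
pose F n := U @^-1` `]r - n.+1%:R^-1, r + n.+1%:R^-1].
have mF n : measurable (F n) by exact: measurable_funPTI.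
have e0 n : 0 < n.+1%:R^-1 :> R by rewrite invr_gt0.
have -> : (fun n => fine (cdf U (r + n.+1%:R^-1))
    - fine (cdf U (r - n.+1%:R^-1))) = fine \o (P \o F).
  apply/funext => n /=; rewrite cdfB_itv//.
  by rewrite (@le_trans _ _ r)// ?gerBl ?lerDl ltW.
apply: fine_cvg; rewrite -probability_fineE; last exact: measurable_funPTI.
have -> : U @^-1` [set r] = \bigcap_n F n.
  apply/seteqP; split => t /=.
    by move=> Ut n _; rewrite /F/= Ut in_itv/= gtrBl e0 lerDl ltW.
  move=> Ft; apply/eqP; rewrite -subr_eq0 -normr_le0.
  apply/ler_addgt0Pr => e e_gt0; rewrite add0r.
  have [n _ /(_ n (leqnn _)) /= ne] := near_infty_natSinv_lt (PosNum e_gt0).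
  apply/(le_trans _ (ltW ne)); have := Ft n I; rewrite /F/= in_itv/= => /andP[].
  rewrite ltrBlDr ler_norml lerBlDl lerBrDr => /ltW r1 ->.
  by rewrite addrC lerBlDr r1.
apply: nonincreasing_cvg_mu => //.
- by rewrite -ge0_fin_numE// fin_num_measure.
- exact: bigcap_measurable.
- move=> n k nk; apply/subsetPset => t; rewrite /F/= !in_itv/=.
  have : k.+1%:R^-1 <= n.+1%:R^-1 :> R by rewrite lef_pV2 ?posrE ?ler_nat.
  move=> kn /andP[rt tr]; apply/andP; split.
    by apply: le_lt_trans rt; rewrite lerD2l lerN2.
  by apply: (le_trans tr); rewrite lerD2l.
Qed.

Lemma cdf_continuous_pmf0 (r : R) : pmf U r = 0 -> {for r, continuous (cdf U)}.
Proof.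
move=> U0; have := @cvg_cdf_window r; rewrite U0 => /cvgrPdist_lt W.
suff: cdf U s @[s --> r] --> (f r)%:E by rewrite -cdfE.
apply: cvg_EFin.
  by near=> s; rewrite cdfE.
apply/cvgrPdist_lt => e e0; have [n _ /(_ n (leqnn _)) /=] := W _ e0.
rewrite -/(f _) -/(f _) sub0r normrN ger0_norm; last first.
  by rewrite subr_ge0 f_homo// (@le_trans _ _ r)// ?gerBl ?lerDl// invr_ge0.
move=> fe; have n0 : 0 < n.+1%:R^-1 :> R by rewrite invr_gt0.
near=> s.
have rs : `|r - s| < n.+1%:R^-1.
  by near: s; exact: cvgr_dist_lt.
move: rs; rewrite ltr_distlC => /andP[rs sr].
have := f_homo (ltW rs); have := f_homo (ltW sr).
have : f (r - n.+1%:R^-1) <= f r by rewrite f_homo// gerBl ltW.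
have : f r <= f (r + n.+1%:R^-1) by rewrite f_homo// lerDl ltW.
rewrite /= -/(f s) ltr_norml; lra.
Unshelve. all: by end_near. Qed.

(** Continuity points are dense: the atoms are countable, whereas an open
    interval has positive Lebesgue measure. *)
Lemma cdf_continuity_point (u v : R) : u < v ->
  exists2 r, u < r < v & {for r, continuous (cdf U)}.
Proof.
move=> uv; apply: contrapT => nr.
have /countable_lebesgue_measure0 I0 : countable (`]u, v[%classic : set R).
  apply: sub_countable (pmf_gt0_countable U); apply: subset_card_le.
  move=> r /=; rewrite in_itv/= => uvr; rewrite lt_neqAle pmf_ge0 andbT.
  apply/eqP => /esym U0; apply: nr; exists r => //.
  exact: cdf_continuous_pmf0.
have := lebesgue_measure_itv `]u, v[; rewrite I0 /= lte_fin uv -EFinB.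
by move=> [] /eqP; rewrite eq_sym subr_eq0 gt_eqF.
Qed.

End cdf_windows.

(** * Convergence in distribution on a finite set *)

(** For variables with values in a common finite set, convergence in
    distribution yields convergence of the weights of the points of that set:
    between continuity points of the limit that surround a single [x j], the
    increment of the distribution functions is exactly the weight of [x j]. *)
Lemma cvg_pmf (R : realType) (N : nat) (x : 'I_N -> R)
    d1 (T1 : measurableType d1) (P1 : probability T1 R)
    (Y : nat -> {RV P1 >-> R})
    d2 (T2 : measurableType d2) (P2 : probability T2 R) (xi : {RV P2 >-> R}) :
  injective x -> (forall n, takes_values_in (Y n) (range x)) ->
  cvg_in_distribution Y xi ->
  forall j, pmf (Y n) (x j) @[n --> \oo] --> pmf xi (x j).
Proof.
move=> x_inj Yx Yxi j.
have xi_homo r s : r <= s -> fine (cdf xi r) <= fine (cdf xi s).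
  by move=> rs; rewrite fine_le ?cdf_nondecreasing// fin_num_measure.
have /cvgrPdist_lt W := @cvg_cdf_window _ _ _ _ xi (x j).
apply/cvgrPdist_lt => e e0.
have e20 : 0 < e / 2 by rewrite divr_gt0.
(* From some rank on, the window around [x j] meets no other point of chi. *)
have gap : \forall n \near \oo, forall i, i != j ->
    n.+1%:R^-1 < `|x i - x j|.
  apply: filter_forall => i; have [ij|ij] := eqVneq i j; first exact: nearW.
  have xij : 0 < `|x i - x j| by rewrite normr_gt0 subr_eq0 (inj_eq x_inj).
  by apply: filterS (near_infty_natSinv_lt (PosNum xij)).
(* [u] and [v] are taken between the windows of ranks [K] and [K.+1], so that
   the increment of [cdf xi] over ]u, v] lies between those over the two
   windows. *)
have [K _ WK] := filterI gap (W _ e20).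
have [gapK DK] := WK K (leqnn K).
have [_ DK1] := WK K.+1 (leqnSn K).
have KK1 : K.+2%:R^-1 < K.+1%:R^-1 :> R by rewrite ltf_pV2 ?posrE// ltr_nat.
have K20 : 0 < K.+2%:R^-1 :> R by rewrite invr_gt0.
have [u /andP[u1 u2] cu] : exists2 u,
    x j - K.+1%:R^-1 < u < x j - K.+2%:R^-1 & {for u, continuous (cdf xi)}.
  by apply: cdf_continuity_point; rewrite ltrD2l ltrN2.
have [v /andP[v1 v2] cv] : exists2 v,
    x j + K.+2%:R^-1 < v < x j + K.+1%:R^-1 & {for v, continuous (cdf xi)}.
  by apply: cdf_continuity_point; rewrite ltrD2l.
have uj : u < x j by apply: lt_trans u2 _; rewrite gtrBl.
have jv : x j < v by apply: le_lt_trans v1; rewrite lerDl ltW.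
have pmfE n : fine (cdf (Y n) v) - fine (cdf (Y n) u) = pmf (Y n) (x j).
  rewrite cdfB_itv; last exact/ltW/(lt_trans uj).
  rewrite (distribution_sum x_inj)// (big_pred1 j)// => i.
  apply/idP/eqP => [|->]; rewrite inE/= in_itv/=; last by rewrite uj ltW.
  move=> /andP[ui iv]; apply/eqP; apply: contraTT isT => /gapK.
  rewrite ltNge ler_distl => /negP[]; apply/andP; split.
    exact/ltW/(lt_trans u1).
  exact/ltW/(le_lt_trans iv).
have cvg_cdf r : {for r, continuous (cdf xi)} ->
    fine (cdf (Y n) r) @[n --> \oo] --> fine (cdf xi r).
  by move=> /Yxi cr; apply: fine_cvg; rewrite fineK// fin_num_measure.
have : fine (cdf (Y n) v) - fine (cdf (Y n) u) @[n --> \oo] -->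
    fine (cdf xi v) - fine (cdf xi u) by apply: cvgB; exact: cvg_cdf.
move=> /cvgrPdist_lt /(_ _ e20); apply: filterS => n /=; rewrite pmfE.
move: DK DK1 (xi_homo _ _ (ltW u1)) (xi_homo _ _ (ltW u2)).
move: (xi_homo _ _ (ltW v1)) (xi_homo _ _ (ltW v2)) => /=.
rewrite !ltr_norml; lra.
Qed.

Lemma cvg_sumr (R : realType) (I : Type) (r : seq I) (F : I -> nat -> R)
    (l : I -> R) :
  (forall i, F i n @[n --> \oo] --> l i) ->
  \sum_(i <- r) F i n @[n --> \oo] --> \sum_(i <- r) l i.
Proof. by move=> Fl; apply: cvg_big => //; exact: add_continuous. Qed.

Theorem theorem1 (R : realType) (N : nat) (x : 'I_N -> R) (A : 'M[R]_N)
    (x_inj : injective x)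
    (A_lut : lookup_table x A)
    (A_assoc : lut_associative x A)
    (d : measure_display) (T : measurableType d) (P : probability T R)
    (X : nat -> {RV P >-> R})
    (X_chi : forall k, takes_values_in (X k) (range x))
    (X_iid : iid X)
    (d' : measure_display) (T' : measurableType d') (P' : probability T' R)
    (xi : {RV P' >-> R})
    (X_cvg : cvg_in_distribution
               (fun n => oplus_sum x A X n : {RV P >-> R}) xi) :
  lut_stable x A xi.
Proof.
have Sx := takes_values_in_oplus_sum x_inj A_lut X_chi.
have S_cvg := cvg_pmf x_inj Sx X_cvg.
pose S n : {RV P >-> R} := oplus_sum x A X n.
(* No mass escapes from chi in the limit, because chi is finite. *)
have xi_chi : takes_values_in xi (range x).
  apply: takes_values_in_sum_pmf => //.
  have : \sum_j pmf (S n) (x j) @[n --> \oo] --> \sum_j pmf xi (x j).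
    by apply: cvg_sumr => j; exact: S_cvg.
  under eq_fun do rewrite sum_pmf//.
  by move=> H; apply: (cvg_unique _ H); last exact: cvg_cst.
have xi_conv c : pmf xi (x c) =
    conv (prod_index x A) (pmf xi \o x) (pmf xi \o x) c.
  (* The weights of an even number of terms have [pmf xi] for limit along a
     subsequence, and the self-convolution of [pmf xi] by [pmf_oplus_sumD]. *)
  have S2 : pmf (S (n + n).+1) (x c) @[n --> \oo] --> pmf xi (x c).
    have doubling : (n + n).+1 @[n --> \oo] --> \oo.
      apply/cvgnyPge => k; exists k => // n /= kn.
      exact: leq_trans kn (leqW (leq_addr n n)).
    exact: (cvg_comp _ (fun k => pmf (S k) (x c)) doubling (@S_cvg c)).
  apply: (cvg_unique _ S2) => //.
  have -> : (fun n => pmf (S (n + n).+1) (x c)) = fun n =>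
      conv (prod_index x A) (pmf (S n) \o x) (pmf (S n) \o x) c.
    by apply/funext => n; apply: pmf_oplus_sumD => //; exact: prod_indexA.
  apply: cvg_sumr => a; apply: cvg_sumr => b.
  by apply: cvgMr; apply: cvgM; exact: S_cvg.
split=> // e E Q xi1 xi2 l1 l2 ind.
have chi Y : same_law Y xi -> takes_values_in Y (range x).
  move=> l; apply: takes_values_in_sum_pmf => //.
  rewrite -(sum_pmf x_inj xi_chi); apply: eq_bigr => j _.
  by rewrite /pmf; congr fine; exact: (l [set x j]).
have pmf_l Y : same_law Y xi -> pmf Y = pmf xi.
  by move=> l; apply/funext => r; rewrite /pmf; congr fine; exact: (l [set r]).
apply: (same_law_pmf x_inj) => //.
  by apply: takes_values_in_oplus => //; exact: chi.
move=> c; rewrite pmf_oplus//; try exact: chi.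
by rewrite !pmf_l.
Qed.
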